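(* Let $\mathcal{P}\subset\mathbb{R}^n$ be the boundary of a convex polytope with $m$ bounding hyperplanes (faces), whose interior contains the origin. For every $\epsilon>0$ there is a set $B=B_\epsilon\subset\mathbb{R}^n$ containing a homothetic copy of $\mathcal{P}$ centered at every point $x\in\mathbb{R}^n$ such that \[\dim_P B=n-\frac{1}{m}+\epsilon.\]
   Context: A homothetic copy of $\mathcal{P}$ centered at $x$ is a set $x+r\mathcal{P}$ with $r>0$. $\dim_P$ denotes packing dimension.
   Formalization: The claim is stated for 0 < ε ≤ 1/m only (and n ≥ 1): for ε > 1/m the prescribed dimension n − 1/m + ε exceeds n, which no subset of R^n can have. *)

(* Defs.v *)
From HB Require Import structures.
From mathcomp Require Import all_boot all_order all_algebra.
From mathcomp Require Import all_classical all_reals all_analysis.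

Set Implicit Arguments.
Unset Strict Implicit.
Unset Printing Implicit Defensive.

Import Order.TTheory GRing.Theory Num.Theory.
Import numFieldNormedType.Exports.

Local Open Scope classical_set_scope.
Local Open Scope ring_scope.

Section Euclidean.
Context {R : realType} {n : nat}.
Implicit Types (u v c x : 'rV[R]_n) (A K P : set 'rV[R]_n).

Definition dot u v : R := \sum_(i < n) u 0 i * v 0 i.

(* The library norm on 'rV[R]_n is the sup norm; it induces the same topology
   and the same bounded sets as this one. *)
Definition eucl_norm u : R := Num.sqrt (dot u u).

Definition eucl_ball c (r : R) : set 'rV[R]_n :=
  [set x | eucl_norm (x - c) <= r].

Definition boundary A : set 'rV[R]_n := closure A `\` interior A.

Definition halfspace u (b : R) : set 'rV[R]_n := [set x | dot u x <= b].

(* The last clause says that no half-space can be dropped. For K with nonempty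
   interior, this makes the hyperplanes dot (a i) x = b i pairwise distinct and
   exactly the affine hulls of the (n-1)-dimensional faces of K, so that m is
   the number of these faces. *)
Definition convex_polytope_with_faces (m : nat) K : Prop :=
  bounded_set K /\
  exists (a : 'I_m -> 'rV[R]_n) (b : 'I_m -> R),
    [/\ forall i, a i != 0,
        K = \bigcap_(i in [set: 'I_m]) halfspace (a i) (b i) &
        forall i, K <> \bigcap_(j in [set j | j != i]) halfspace (a j) (b j)].

Definition homothetic_copy P x (r : R) : set 'rV[R]_n :=
  [set x + r *: p | p in P].

Definition covered_by_balls A (d : R) (k : nat) : Prop :=
  exists c : 'I_k -> 'rV[R]_n,
    A `<=` \bigcup_(i in [set: 'I_k]) eucl_ball (c i) d.

(* Equal to +oo when A has no finite cover. *)
Definition covering_number A (d : R) : \bar R :=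
  ereal_inf [set (k%:R)%:E | k in [set k | covered_by_balls A d k]].

(* limsup of log N(A, d) / log (1/d) as d -> 0+; equal to -oo for A empty. *)
Definition upper_minkowski_dim A : \bar R :=
  limf_esup (fun d : R => (lne (covering_number A d) * ((- ln d)^-1)%:E)%E)
    (0 : R)^'+.

(* Packing dimension as in Mattila, Geometry of Sets and Measures in Euclidean
   Spaces, Section 5.9: the infimum of sup_i (upper Minkowski dimension of A_i)
   over all countable covers of A by bounded sets A_i. *)
Definition packing_dim A : \bar R :=
  ereal_inf
    [set s | exists A_ : nat -> set 'rV[R]_n,
       [/\ forall i, bounded_set (A_ i),
           A `<=` \bigcup_i A_ i &
           s = ereal_sup (range (fun i => upper_minkowski_dim (A_ i)))]].

End Euclidean.

(* Main.v *)
Require Import Defs.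
From HB Require Import structures.
From mathcomp Require Import all_boot all_order all_algebra.
From mathcomp Require Import all_classical all_reals all_analysis.
From mathcomp Require Import ring lra zify.

(** Normalise the faces of K to dot (a_i / b_i) p = 1.  The copy x + rP lies in
    the hyperplanes dot (a_i / b_i) y = t_i + r with t_i = dot (a_i / b_i) x.
    For a large base N, let T_i be the set of reals t such that N^(i + j m) t
    exceeds an integer by at most 2 / N, for all j.  Controlling one N-adic
    digit out of m costs 1/m in dimension, so T_i has box dimension close to
    1 - 1/m, and since the controlled positions of the T_i are disjoint, for
    all t_0, ..., t_(m-1) one r puts t_i + r in T_i for every i.  The union of
    the hyperplanes {dot (a_i / b_i) y in T_i} contains all these copies and has
    packing dimension at most n - 1/m + eps; adding a Cantor set of packing
    dimension exactly n - 1/m + eps gives equality. *)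

Import Order.TTheory GRing.Theory Num.Theory.
Import numFieldNormedType.Exports.

Local Open Scope classical_set_scope.
Local Open Scope ring_scope.

(** * Nested intervals and a common shift to near-integers *)

Lemma nested_intervals (R : realType) (a b : nat -> R) :
  (forall k, a k <= a k.+1) -> (forall k, b k.+1 <= b k) ->
  (forall k, a k <= b k) -> exists r, forall k, a k <= r <= b k.
Proof.
move=> a_nd b_ni ab.
have mono_a k l : (k <= l)%N -> a k <= a l.
  move=> /subnKC <-; elim: (l - k)%N => [|i IH]; rewrite ?addn0 ?addnS//.
  exact: le_trans IH _.
have mono_b k l : (k <= l)%N -> b l <= b k.
  move=> /subnKC <-; elim: (l - k)%N => [|i IH]; rewrite ?addn0 ?addnS//.
  exact: le_trans IH.
have le_ab k l : a k <= b l.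
  case: (leqP k l) => [/mono_a/le_trans|/ltnW/mono_b]; first exact.
  exact/le_trans/ab.
exists (sup (range a)) => k; apply/andP; split.
  by apply: ub_le_sup; [exists (b 0%N) => _ [l _ <-]|exists k].
by apply: ge_sup; [exists (a 0%N), 0%N|move=> _ [l _ <-]].
Qed.

Lemma simultaneous_shift (R : realType) (N : nat) (t : nat -> R) :
  (1 < N)%N -> exists r : R, 0 < r /\ forall k, exists z : int,
    z%:~R <= N%:R ^+ k * (t k + r) <= z%:~R + 2 / N%:R.
Proof.
(* Greedily move r up by less than N^-k so that N^k (t k + r) becomes an
   integer; the later moves add at most 2 N^-(k+1) in total. *)
move=> N1; have N0 : 0 < N%:R :> R by rewrite ltr0n; lia.
have N2 : 2 <= N%:R :> R by rewrite ler_nat.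
pose x k (r : R) := N%:R ^+ k * (t k + r).
pose step k (r : R) := r + ((Num.ceil (x k r))%:~R - x k r) / N%:R ^+ k.
(* Starting at 1 makes the limit positive. *)
pose r_ := fix r_ k := if k is k.+1 then step k (r_ k) else 1.
have X0 k : 0 < N%:R ^+ k :> R by exact: exprn_gt0.
have x_step k r : x k (step k r) = (Num.ceil (x k r))%:~R.
  have := X0 k; rewrite /step {1}/x; set w := (_ - _) => Xk0.
  rewrite addrA mulrDr -/(x k r) mulrCA divff ?gt_eqF// mulr1 /w.
  by rewrite addrCA subrr addr0.
have step_ge k r : r <= step k r.
  by rewrite lerDl divr_ge0 ?(ltW (X0 k))// subr_ge0 ceil_ge.
have step_le k r : step k r <= r + 1 / N%:R ^+ k.
  rewrite lerD2l ler_pM2r ?invr_gt0 ?X0//.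
  by have := ceilB1_lt (x k r); rewrite intrD; lra.
(* Step [k] adds at most [N^-k]; as [N] is at least 2, all moves from stage [k] on add at most
   [2 N^-k], which makes these intervals nested. *)
have [k|k|k|r r_itv] := @nested_intervals R r_ (fun k => r_ k + 2 / N%:R ^+ k).
- exact: step_ge.
- rewrite /= exprS invfM mulrA.
  have := step_le k (r_ k); set Y := (_ ^+ _)^-1.
  have Y0 : 0 < Y by rewrite invr_gt0.
  have : 2 / N%:R <= 1 :> R by rewrite ler_pdivrMr// mul1r.
  nra.
- by rewrite lerDl divr_ge0// ltW.
exists r; split; first by have := r_itv 0%N => /=; lra.
move=> k; exists (Num.ceil (x k (r_ k))).
have /andP[lo hi] := r_itv k.+1.
rewrite -x_step /x -/(r_ k.+1) ler_pM2l// lerD2l lo/=.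
rewrite -[r_ k.+1]/(step k (r_ k)) in hi *.
apply: (@le_trans _ _ (N%:R ^+ k * (t k + (step k (r_ k) + 2 / N%:R ^+ k.+1)))).
  by rewrite ler_pM2l// lerD2l.
rewrite addrA mulrDr lerD2l le_eqVlt; apply/orP; left; apply/eqP.
by rewrite exprS; field; rewrite !gt_eqF ?X0.
Qed.

(** * Covering numbers and Minkowski dimension *)

Section Covers.
Context {R : realType} {n : nat}.
Implicit Types (A : set 'rV[R]_n) (u v y : 'rV[R]_n).

Lemma eucl_norm_le_coord u (d : R) : 0 <= d ->
  (forall i, `|u 0 i| <= d) -> eucl_norm u <= n%:R * d.
Proof.
move=> d0 ud; rewrite -(ger0_norm (mulr_ge0 (ler0n R n) d0)) -sqrtr_sqr.
apply: ler_wsqrtr; apply: (@le_trans _ _ (\sum_(i < n) d ^+ 2)).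
  apply: ler_sum => i _; rewrite -expr2 -real_normK ?num_real//.
  by rewrite lerXn2r// nnegrE.
rewrite sumr_const card_ord -[d ^+ 2 *+ n]mulr_natl exprMn ler_wpM2r ?sqr_ge0//.
by rewrite -natrX ler_nat; case: (n) => // k; rewrite expnS; nia.
Qed.

Lemma coord_le_eucl_norm u i : `|u 0 i| <= eucl_norm u.
Proof.
rewrite -sqrtr_sqr; apply: ler_wsqrtr; rewrite /dot (bigD1 i)//= -expr2 lerDl.
by apply: sumr_ge0 => j _; rewrite -expr2 sqr_ge0.
Qed.

Lemma covered_by_cells A (d : R) (W : finType) (cell : W -> set 'rV[R]_n) :
  (forall y, A y -> exists w, cell w y) ->
  (forall w y y', cell w y -> cell w y' -> eucl_norm (y - y') <= d) ->
  covered_by_balls A d #|W|.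
Proof.
move=> A_cell cell_d; exists (fun i => get (cell (enum_val i))) => y Ay.
have [w wy] := A_cell _ Ay; exists (enum_rank w) => //=.
rewrite /eucl_ball/= enum_rankK; apply: (cell_d w) => //.
by apply: (@getPex _ (cell w)); exists y.
Qed.

Lemma covered_by_ballsS A (d d' : R) k :
  d <= d' -> covered_by_balls A d k -> covered_by_balls A d' k.
Proof.
move=> dd' [c Ac]; exists c => y /Ac[i _ /= yi]; exists i => //=.
exact: le_trans dd'.
Qed.

Local Open Scope ereal_scope.

Lemma covering_number_le A d k :
  covered_by_balls A d k -> covering_number A d <= k%:R%:E.
Proof. by move=> Ak; apply: ereal_inf_lbound; exists k. Qed.

Lemma lne_le_ln (x : \bar R) (r : R) : (0 < r)%R -> x <= r%:E ->
  lne x <= (ln r)%:E.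
Proof.
case: x => [x||]//=; last by rewrite !leNye.
rewrite lee_fin => r0 xr; case: ifPn => [_|]; first by rewrite leNye.
by rewrite -ltNge => x0; rewrite lee_fin ler_ln.
Qed.

Lemma ln_le_lne (x : \bar R) (r : R) : (0 < r)%R -> r%:E <= x ->
  (ln r)%:E <= lne x.
Proof.
case: x => [x||]//=; last by rewrite !leey.
rewrite lee_fin => r0 rx; rewrite ifF ?lee_fin ?ler_ln ?posrE//.
  exact: lt_le_trans rx.
by apply/negbTE; rewrite -ltNge (lt_le_trans r0).
Qed.

(** Passing from any radius to the next scale [c / M ^ j] below it costs at most a factor [M], which
    changes logarithms by a bounded amount, negligible against [- ln d]. *)
Lemma upper_minkowski_dim_le A (M c c0 s : R) :
  (1 < M)%R -> (0 < c)%R -> (0 < c0)%R -> (0 <= s)%R ->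
  (forall j, exists k, covered_by_balls A (c / M ^+ j) k /\
     (k%:R <= c0 * (M `^ s) ^+ j)%R) ->
  upper_minkowski_dim A <= s%:E.
Proof.
move=> M1 c_gt0 c0_gt0 s_ge0 Acov; apply/lee_addgt0Pr => e e0.
have lnM_gt0 : (0 < ln M)%R by rewrite ln_gt0.
(* [H] gathers the terms independent of [d]. The minimum [D] ensures [d < c], so that [x] below is
   nonnegative, [d < 1], and [H <= e * (- ln d)]. *)
pose H := (ln c0 + s * (ln c + ln M))%R.
pose D := Num.min (Num.min c 1%R) (expR (- (`|H| / e))).
have D0 : (0 < D)%R by rewrite !lt_min c_gt0 ltr01 expR_gt0.
apply: (@le_trans _ _ (ereal_sup ((fun d : R =>
    lne (covering_number A d) * ((- ln d)^-1)%:E) @` `]0%R, D[))).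
  apply: ereal_inf_lbound; exists `]0%R, D[%classic => //.
  exists D => //= y /=; rewrite sub0r normrN => yD y0.
  by rewrite in_itv/= y0 (le_lt_trans (ler_norm _) yD).
apply: ge_ereal_sup => _ [d /= + <-].
rewrite in_itv/= !lt_min => /andP[d0 /andP[/andP[dc d1] dH]].
have lnd : (0 < - ln d)%R by rewrite oppr_gt0 ln_lt0// d0.
pose x := (ln (c / d) / ln M)%R.
have x0 : (0 <= x)%R.
  by rewrite divr_ge0 ?(ltW lnM_gt0)// ln_ge0// ler_pdivlMr// mul1r ltW.
have xlnM : (x * ln M = ln (c / d))%R by rewrite mulfVK ?gt_eqF.
pose j := (Num.truncn x).+1.
have xj : (x < j%:R)%R by exact: truncnS_gt.
have jx : (j%:R <= x + 1)%R.
  by rewrite /j -natr1 lerD2r truncn_le.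
have [k [Ak kle]] := Acov j.
have M0 : (0 < M)%R by exact: lt_trans M1.
have Ms0 : (0 < M `^ s)%R by exact: powR_gt0.
have lnE : (ln (c / d) = ln c - ln d)%R by rewrite ln_div.
have Ad : covered_by_balls A d k.
  apply: covered_by_ballsS Ak.
  rewrite ler_pdivrMr ?exprn_gt0// mulrC -ler_pdivrMr//.
  rewrite -ler_ln ?posrE ?divr_gt0 ?exprn_gt0//.
  by rewrite lnXn// -[leRHS]mulr_natl -xlnM ler_pM2r// ltW.
have : lne (covering_number A d) <= (H + s * (- ln d))%:E.
  apply: (@le_trans _ _ (ln (c0 * (M `^ s) ^+ j))%:E).
    apply: lne_le_ln; first by rewrite mulr_gt0// exprn_gt0.
    by apply: le_trans (covering_number_le _ _ _ Ad) _; rewrite lee_fin.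
  rewrite lee_fin lnM ?posrE ?exprn_gt0// lnXn// ln_powR.
  rewrite -[(s * ln M *+ j)%R]mulr_natr.
  have : (j%:R * ln M <= ln c - ln d + ln M)%R.
    by rewrite -lnE -xlnM -[X in (_ + X)%R]mul1r -mulrDl ler_pM2r.
  move=> jM; rewrite /H -addrA -mulrDr lerD2l -mulrA ler_wpM2l//.
  by rewrite mulrC (le_trans jM)// addrAC.
move=> /(@lee_wpmul2r _ ((- ln d)^-1)%:E) => /(_ _)/le_trans; apply.
  by rewrite lee_fin invr_ge0 ltW.
rewrite -EFinM -EFinD lee_fin mulrDl mulfK ?gt_eqF// addrC lerD2l.
rewrite ler_pdivrMr//.
have : (ln d < - (`|H| / e))%R.
  by rewrite -[X in (_ < X)%R]expRK ltr_ln ?posrE ?expR_gt0.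
rewrite ltrNr ltr_pdivrMr// mulrC => /ltW; apply: le_trans.
exact: ler_norm.
Qed.

(** Turns the limsup into covers at every small scale; the gap between [s'] and [s] is what the
    count for the Cantor set exploits. *)
Lemma upper_minkowski_dim_lt A (s : R) : upper_minkowski_dim A < s%:E ->
  exists s' d0 : R, [/\ (s' < s)%R, (0 < d0)%R & forall d, (0 < d < d0)%R ->
    exists2 k, covered_by_balls A d k & (k%:R < d `^ (- s'))%R].
Proof.
move=> As.
have [s' As' s's] : exists2 s' : R, upper_minkowski_dim A < s'%:E & (s' < s)%R.
  move: As; case: upper_minkowski_dim => [r||]//.
    by rewrite lte_fin => rs; exists ((r + s) / 2)%R; rewrite ?lte_fin; lra.
  by move=> _; exists (s - 1)%R; [rewrite ltNyr|lra].
have := As'; rewrite /upper_minkowski_dim limf_esupE.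
move=> /ereal_inf_lt[_ [V V0 <-] /= Vs'].
have [d1 /= d10 Vd1] := V0.
exists s', (Num.min d1 1%R); split=> //; first by rewrite lt_min d10/=.
move=> d /andP[d0]; rewrite lt_min => /andP[dd1 d1'].
have lnd : (0 < - ln d)%R by rewrite oppr_gt0 ln_lt0// d0.
have {}Vs' : lne (covering_number A d) * ((- ln d)^-1)%:E < s'%:E.
  apply: le_lt_trans Vs'; apply: ereal_sup_ubound; exists d => //.
  by apply: Vd1 => //=; rewrite sub0r normrN gtr0_norm.
have X0 : (0 < d `^ (- s'))%R by exact: powR_gt0.
have : covering_number A d < (d `^ (- s'))%:E.
  rewrite ltNge; apply/negP => /(ln_le_lne _ _ X0).
  rewrite ln_powR => /(@lee_wpmul2r _ ((- ln d)^-1)%:E).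
  rewrite lee_fin invr_ge0 => /(_ (ltW lnd)).
  rewrite -EFinM mulNr -mulrN mulfK ?gt_eqF// => /le_lt_trans/(_ Vs').
  by rewrite ltxx.
by move=> /ereal_inf_lt[_ [k Ak <-]]; rewrite lte_fin; exists k.
Qed.

Lemma packing_dim_le A (A_ : nat -> set 'rV[R]_n) (s : \bar R) :
  (forall i, bounded_set (A_ i)) -> A `<=` \bigcup_i A_ i ->
  (forall i, upper_minkowski_dim (A_ i) <= s) -> packing_dim A <= s.
Proof.
move=> A_bnd AA A_s; apply: (@le_trans _ _
  (ereal_sup (range (fun i => upper_minkowski_dim (A_ i))))).
  by apply: ereal_inf_lbound; exists A_.
by apply: ge_ereal_sup => _ [i _ <-].
Qed.

Lemma bounded_set_coord A (d : R) :
  (forall y, A y -> forall i, (`|y 0 i| <= d)%R) -> bounded_set A.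
Proof.
move=> Ad; exists (Num.max d 0)%R; split; first exact: num_real.
move=> M; rewrite gt_max => /andP[dM M0] y Ay /=.
rewrite /Num.norm/= mx_normrE; apply: bigmax_le => [|[i j] _]; first exact: ltW.
by rewrite ord1 (le_trans (Ad _ Ay _))// ltW.
Qed.

End Covers.

(** * Strips on which a linear form is near integers *)

(** For [M = N ^ m.+1] each [j] restricts one base-[N] digit, the first after the point in
    [M ^ j * u], to essentially 0 or 1; the [m] digits after it stay free. *)
Definition near_integers {R : realType} (M N : nat) : set R :=
  [set u | forall j, exists z : int,
     z%:~R <= M%:R ^+ j * u <= z%:~R + 2 / N%:R].

(** With [M = N ^ m.+1], a level-[j] integer [z] confines [M ^ j.+1 * u] to the range from [M z] to
    [M z + 2 N ^ m], so it has at most [2 N ^ m + 1 <= 3 N ^ m] successors instead of about [M]. *)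
Lemma near_integers_cells (R : realType) (N m L j : nat) : (2 < N)%N ->
  exists S : seq int, (size S <= (2 * L + 3) * (3 * N ^ m) ^ j)%N /\
    forall u : R, near_integers (N ^ m.+1) N u -> `|u| <= L%:R ->
      exists2 z, z \in S &
        z%:~R <= (N ^ m.+1)%:R ^+ j * u <= z%:~R + 2 / N%:R.
Proof.
move=> N2; have N0 : 0 < N%:R :> R by rewrite ltr0n; lia.
have NS : 2 / N%:R < 1 :> R by rewrite ltr_pdivrMr// mul1r ltr_nat.
have N_ge0 : 0 <= 2 / N%:R :> R by rewrite divr_ge0// ltW.
elim: j => [|j [S [S_size S_cells]]].
  exists [seq i%:Z - L.+1%:Z | i <- iota 0 (2 * L + 3)]; split.
    by rewrite size_map size_iota expn0 muln1.
  move=> u u_near; rewrite ler_norml => /andP[uL Lu].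
  have [z zu] := u_near 0%N; exists z => //.
  move: zu; rewrite expr0 mul1r => /andP[zu uz].
  have z_hi : z <= L%:Z by rewrite -(ler_int R); apply: le_trans Lu.
  have z_lo : - L.+1%:Z < z.
    rewrite -(ltr_int R) rmorphN/= -pmulrn -natr1; lra.
  apply/mapP; exists `|(z + L.+1%:Z)%R|%N; last by lia.
  by rewrite mem_iota; lia.
exists [seq (N ^ m.+1)%:Z * z + e%:Z | z <- S, e <- iota 0 (3 * N ^ m)]; split.
  by rewrite size_allpairs size_iota expnSr [leqRHS]mulnA leq_mul2r S_size orbT.
move=> u u_near uL; have [z zS /andP[zu uz]] := S_cells u u_near uL.
have [z' /andP[z'u uz']] := u_near j.+1; exists z'; last by rewrite z'u.
have M0 : 0 < (N ^ m.+1)%:R :> R by rewrite ltr0n expn_gt0; lia.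
rewrite exprS -mulrA in z'u uz'.
have lo : (N ^ m.+1)%:R * z%:~R <= (N ^ m.+1)%:R * ((N ^ m.+1)%:R ^+ j * u).
  by rewrite ler_pM2l.
have hi : (N ^ m.+1)%:R * ((N ^ m.+1)%:R ^+ j * u) <=
    (N ^ m.+1)%:R * z%:~R + 2 * (N ^ m)%:R.
  have -> : 2 * (N ^ m)%:R = (N ^ m.+1)%:R * (2 / N%:R) :> R.
    by rewrite expnS natrM; field; rewrite gt_eqF.
  by rewrite -mulrDr ler_pM2l.
have z'_lo : (N ^ m.+1)%:Z * z < z' + 1.
  by rewrite -(ltr_int R) intrM intrD; lra.
have z'_hi : z' <= (N ^ m.+1)%:Z * z + (2 * N ^ m)%:Z.
  by rewrite -(ler_int R) intrD intrM -!pmulrn natrM; lra.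
have Nm : (0 < N ^ m)%N by rewrite expn_gt0; lia.
apply/allpairsP; exists (z, `|(z' - (N ^ m.+1)%:Z * z)%R|%N); split=> //=.
  by rewrite mem_iota; lia.
by lia.
Qed.

Section Strips.
Context {R : realType} {n : nat}.
Variables (a : 'rV[R]_n.+1) (N m L : nat) (sigma : R).
Hypotheses (a_neq0 : a != 0) (N_gt2 : (2 < N)%N) (sigma_ge0 : 0 <= sigma)
  (N_sigma : (3 * N ^ m)%:R <= (N ^ m.+1)%:R `^ sigma).

Definition strips : set 'rV[R]_n.+1 :=
  [set y : 'rV[R]_n.+1 | (forall i, `|y 0 i| <= L%:R) /\
     near_integers (N ^ m.+1) N (dot a y)].

(** Box counting at scale [M ^- j] with [M = N ^ m.+1]: up to constants, [n] coordinates cost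
    [M ^ (j n)] cells, and the remaining one, with nonzero coefficient in [a], is recovered from
    [dot a y], which costs [(3 N ^ m) ^ j <= M ^ (j sigma)]. *)
Lemma strips_dim : (upper_minkowski_dim strips <= (n%:R + sigma)%:E)%E.
Proof.
have [p ap] : exists p, a 0 p != 0.
  by apply/rV0Pn.
have ap0 : 0 < `|a 0 p| by rewrite normr_gt0.
pose sa : R := \sum_(i < n.+1) `|a 0 i|.
have sa0 : 0 <= sa by exact: sumr_ge0.
pose L' := (Num.truncn (sa * L%:R)).+1.
have dot_le (y : 'rV[R]_n.+1) : (forall i, `|y 0 i| <= L%:R) -> `|dot a y| <= L'%:R.
  move=> yL; apply: (@le_trans _ _ (sa * L%:R)); last exact/ltW/truncnS_gt.
  rewrite /dot (le_trans (ler_norm_sum _ _ _))// /sa mulr_suml.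
  by apply: ler_sum => i _; rewrite normrM ler_wpM2l.
pose M := (N ^ m.+1)%N.
have M1 : 1 < M%:R :> R.
  have Nm : (0 < N ^ m)%N by rewrite expn_gt0; lia.
  by rewrite ltr1n /M expnS; nia.
have M0 : 0 < M%:R :> R by exact: lt_trans M1.
(* Solving for coordinate [p] multiplies errors by at most [(1 + sa) / |a 0 p|]; the added 1 makes
   [c1] serve the other coordinates too. *)
pose c1 := (1 + sa) / `|a 0 p| + 1.
have c1_ge1 : 1 <= c1 by rewrite lerDr divr_ge0// addr_ge0.
apply: (@upper_minkowski_dim_le _ _ _ M%:R (n.+1%:R * c1)
  ((2 * L' + 3) * (2 * L + 1) ^ n)%:R) => //.
- by rewrite mulr_gt0//; exact: lt_le_trans c1_ge1.
- by rewrite addr_ge0.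
move=> j; have [S [S_size S_cells]] := near_integers_cells R N m L' j N_gt2.
pose W : finType := ('I_(size S) * {ffun 'I_n -> 'I_((2 * L + 1) * M ^ j)})%type.
have Mj0 : 0 < M%:R ^+ j :> R by exact: exprn_gt0.
pose cell (w : W) : set 'rV[R]_n.+1 := [set y : 'rV[R]_n.+1 |
  (nth 0 S w.1)%:~R <= M%:R ^+ j * dot a y <= (nth 0 S w.1)%:~R + 1 /\
  forall q, (w.2 q)%:R <= M%:R ^+ j * (y 0 (lift p q) + L%:R)
            <= (w.2 q)%:R + 1].
exists #|W|; split.
  apply: (@covered_by_cells _ _ _ _ _ cell) => [y [yL y_near]|w y y'].
    have [z zS /andP[zy yz]] := S_cells _ y_near (dot_le _ yL).
    have zS' : (index z S < size S)%N by rewrite index_mem.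
    pose v q := M%:R ^+ j * (y 0 (lift p q) + L%:R).
    have v_ge0 q : 0 <= v q.
      rewrite mulr_ge0 ?(ltW Mj0)//.
      by have := yL (lift p q); rewrite ler_norml; lra.
    have v_lt q : (Num.truncn (v q) < (2 * L + 1) * M ^ j)%N.
      rewrite truncn_lt_nat// natrM natrX mulrC ltr_pM2l// natrD natrM.
      by have := yL (lift p q); rewrite ler_norml; lra.
    exists (Ordinal zS', [ffun q => Ordinal (v_lt q)]); split=> /=.
      rewrite nth_index// zy (le_trans yz)// lerD2l.
      by rewrite ler_pdivrMr ?mul1r ?ler_nat ?ltr0n; lia.
    move=> q; rewrite ffunE /=.
    by have /andP[-> /ltW] := truncn_itv (v_ge0 q); rewrite -natr1.
  move=> [wy wy_q] [wy' wy'_q].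
  have close_q q : `|(y - y') 0 (lift p q)| <= (M%:R ^+ j)^-1.
    rewrite -(ler_pM2l Mj0) mulfV ?gt_eqF//.
    rewrite -[X in X * _](gtr0_norm Mj0) -normrM !mxE.
    by have := wy_q q; have := wy'_q q; rewrite ler_norml; lra.
  have close_dot : `|dot a y - dot a y'| <= (M%:R ^+ j)^-1.
    rewrite -(ler_pM2l Mj0) mulfV ?gt_eqF//.
    rewrite -[X in X * _](gtr0_norm Mj0) -normrM.
    by rewrite ler_norml; lra.
  set d := (M%:R ^+ j)^-1 in close_q close_dot *.
  have d0 : 0 < d by rewrite invr_gt0.
  have close_p : `|(y - y') 0 p| <= c1 * d.
    have : a 0 p * (y - y') 0 p = dot a y - dot a y'
        - \sum_(q < n) a 0 (lift p q) * (y - y') 0 (lift p q).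
      have -> : dot a y - dot a y' = dot a (y - y').
        by rewrite /dot -sumrB; apply: eq_bigr => i _; rewrite !mxE mulrBr.
      by rewrite /dot (bigD1_ord p)//= addrK.
    move=> /(congr1 (fun x => `|x|)); rewrite normrM => ap_eq.
    have : `|a 0 p| * `|(y - y') 0 p| <= (1 + sa) * d.
      rewrite ap_eq (le_trans (ler_normB _ _))// mulrDl mul1r lerD//.
      rewrite (le_trans (ler_norm_sum _ _ _))// /sa mulr_suml.
      rewrite (bigD1_ord p)//= -[leLHS]add0r lerD ?mulr_ge0 ?(ltW d0)//.
      by apply: ler_sum => q _; rewrite normrM ler_wpM2l.
    rewrite -ler_pdivlMl// => /le_trans; apply.
    by rewrite /c1 [leRHS]mulrDl mul1r mulrA [_^-1 * _]mulrC lerDl ltW.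
  rewrite -mulrA; apply: eucl_norm_le_coord => [|i].
    by rewrite mulr_ge0 ?(ltW d0)// (le_trans _ c1_ge1).
  case: (unliftP p i) => [q ->|->//].
  by apply: (le_trans (close_q q)); rewrite -[leLHS]mul1r ler_pM2r.
rewrite card_prod card_ffun !card_ord expnMn -expnM.
have -> : M%:R `^ (n%:R + sigma) = M%:R ^+ n * M%:R `^ sigma.
  by rewrite powRD ?(gt_eqF M0) ?implybT// powR_mulrn// ltW.
apply: (@le_trans _ _
  ((2 * L' + 3) * (3 * N ^ m) ^ j * ((2 * L + 1) ^ n * M ^ (j * n)))%:R).
  by rewrite ler_nat leq_mul2r S_size orbT.
rewrite mulnACA natrM ler_pM2l; last by rewrite ltr0n muln_gt0 expn_gt0; lia.
rewrite exprMn -exprM [(n * j)%N]mulnC natrM [((3 * _) ^ j)%:R]natrX.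
rewrite [(M ^ _)%:R]natrX mulrC ler_pM2l ?exprn_gt0//.
by rewrite lerXn2r ?nnegrE ?powR_ge0.
Qed.

End Strips.

(** * A Cantor set of prescribed packing dimension *)

Definition agree (q : nat) (nu mu : nat -> bool) :=
  forall r, (r < q)%N -> nu r = mu r.

Lemma eq_mod8_close (z z' : nat) :
  (z %% 8)%N = (z' %% 8)%N -> (z <= z' + 3)%N -> (z' <= z + 3)%N -> z = z'.
Proof. lia. Qed.

Section Cantor.
Context {R : realType} {n : nat}.
Variable s : R.
Hypotheses (n_gt0 : (0 < n)%N) (s_ge0 : 0 <= s) (s_le : s <= n%:R).

Let n0 : 0 < n%:R :> R. Proof. by rewrite ltr0n. Qed.

(* Bit positions p at which this count jumps are free, all others are 0; the
   first k binary digits of the n coordinates then contain about k * s free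
   bits. *)
Definition free_count (p : nat) : nat := Num.truncn (p%:R * (s / n%:R)).

Definition cantor_bit (nu : nat -> bool) (p : nat) : bool :=
  (free_count p < free_count p.+1)%N && nu (free_count p).

(* The bits of the n coordinates are interleaved: the l-th binary digit of
   coordinate i is bit l * n + i. *)
Fixpoint cantor_trunc (nu : nat -> bool) (i k : nat) : nat :=
  if k is l.+1 then (2 * cantor_trunc nu i l + cantor_bit nu (l * n + i))%N
  else 0%N.

(** Closed dyadic intervals at every level replace actual digits, so existence follows by nesting
    and double binary expansions need no special care. *)
Definition cantor_point (nu : nat -> bool) (y : 'rV[R]_n) : Prop :=
  forall (i : 'I_n) k, (cantor_trunc nu i k)%:R <= 2 ^+ k * y 0 i
                       <= (cantor_trunc nu i k)%:R + 1.

Definition cantor_set : set 'rV[R]_n :=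
  [set y | exists nu, cantor_point nu y].

Lemma free_ratio_ge0 p : 0 <= p%:R * (s / n%:R).
Proof. by rewrite mulr_ge0// divr_ge0. Qed.

Lemma free_count0 : free_count 0 = 0%N.
Proof. by rewrite /free_count mul0r truncn0. Qed.

Lemma free_count_mono p q : (p <= q)%N -> (free_count p <= free_count q)%N.
Proof.
by move=> pq; apply: le_truncn; rewrite ler_wpM2r ?divr_ge0// ler_nat.
Qed.

(** The slope [s / n] is at most 1, so the count skips no value. *)
Lemma free_countS p : (free_count p.+1 <= (free_count p).+1)%N.
Proof.
rewrite /free_count truncn_le_nat -[p.+1%:R]natr1 mulrDl mul1r -natr1.
apply: ltr_leD; first exact: truncnS_gt.
by rewrite ler_pdivrMr// mul1r.
Qed.

Lemma free_count_level k :
  (free_count (k * n))%:R <= k%:R * s < (free_count (k * n)).+1%:R.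
Proof.
have := truncn_itv (free_ratio_ge0 (k * n)); rewrite -/(free_count _).
have -> // : (k * n)%:R * (s / n%:R) = k%:R * s.
by rewrite natrM; field; rewrite gt_eqF.
Qed.

Lemma free_count_onto P r : (r < free_count P)%N ->
  exists p, [/\ (p < P)%N, free_count p = r & free_count p.+1 = r.+1].
Proof.
elim: P => [|P IH]; first by rewrite free_count0.
have := free_countS P; have := free_count_mono P P.+1 (leqnSn P).
case: (ltnP r (free_count P)) => [/IH[p [pP <- <-]] _ _ _|rP le_P leS lt_r].
  by exists p; rewrite leqW.
by exists P; split=> //; lia.
Qed.

Lemma cantor_bit_agree nu mu p :
  agree (free_count p.+1) nu mu -> cantor_bit nu p = cantor_bit mu p.
Proof. by rewrite /cantor_bit => eq_nu; case: ltnP => //= /eq_nu. Qed.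

Lemma cantor_trunc_agree nu mu k (i : 'I_n) :
  agree (free_count (k * n)) nu mu -> cantor_trunc nu i k = cantor_trunc mu i k.
Proof.
elim: k => //= k IH eq_nu; congr (2 * _ + _)%N.
  by apply: IH => r rk; apply: eq_nu; apply: leq_trans rk _;
    apply: free_count_mono; rewrite leq_mul2r leqnSn orbT.
congr nat_of_bool; apply: cantor_bit_agree => r rk; apply: eq_nu.
apply: leq_trans rk _; apply: free_count_mono.
by have := ltn_ord i; lia.
Qed.

(** Digits are parities of successive truncations, and each index [r] below the count is read at
    some bit [p], which is digit [p %/ n] of coordinate [p %% n]. *)
Lemma cantor_trunc_inj nu mu k :
  (forall i : 'I_n, cantor_trunc nu i k = cantor_trunc mu i k) ->
  agree (free_count (k * n)) nu mu.
Proof.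
move=> eq_trunc r /free_count_onto[p [pk cp cpS]].
have bits i l : cantor_trunc nu i k = cantor_trunc mu i k -> (l < k)%N ->
    cantor_bit nu (l * n + i) = cantor_bit mu (l * n + i).
  elim: (k) => //= k' IH eq_k; rewrite ltnS leq_eqVlt => /predU1P[->|].
    by move: eq_k; do 2![case: cantor_bit]; lia.
  by apply: IH; move: eq_k; do 2![case: cantor_bit]; lia.
have pn : (p %% n < n)%N by rewrite ltn_mod.
have := bits _ (p %/ n)%N (eq_trunc (Ordinal pn)).
rewrite /= -divn_eq ltn_divLR// => /(_ pk).
by rewrite /cantor_bit cp cpS ltnSn.
Qed.

Lemma cantor_point_exists nu : exists y, cantor_point nu y.
Proof.
have X0 k : 0 < 2 ^+ k :> R by exact: exprn_gt0.
have coord (i : 'I_n) : exists x : R, forall k,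
    (cantor_trunc nu i k)%:R / 2 ^+ k <= x
    <= ((cantor_trunc nu i k)%:R + 1) / 2 ^+ k.
  have halve x k : x / 2 ^+ k.+1 = x / 2 / 2 ^+ k :> R.
    by rewrite exprS invfM mulrA.
  apply: nested_intervals => k.
  - rewrite halve ler_pM2r ?invr_gt0//= natrD natrM.
    by case: cantor_bit => /=; lra.
  - rewrite halve ler_pM2r ?invr_gt0//= natrD natrM.
    by case: cantor_bit => /=; lra.
  - by rewrite ler_pM2r ?invr_gt0// lerDl.
have [x x_coord] := choice coord.
exists (\row_i x i) => i k; rewrite mxE.
by have := x_coord i k; rewrite ler_pdivrMr// ler_pdivlMr// mulrC.
Qed.

Lemma cantor_set_bounded : bounded_set cantor_set.
Proof.
apply: (@bounded_set_coord _ _ _ 1) => y [nu y_nu] i.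
by have := y_nu i 0%N; rewrite /= expr0 mul1r ler_norml; lra.
Qed.

(** The first [free_count (k * n)] bits of [nu] fix a cell of side [2 ^- k], so there are at most
    [2 ^ (k s)] cells. *)
Lemma cantor_set_dim : (upper_minkowski_dim cantor_set <= s%:E)%E.
Proof.
apply: (@upper_minkowski_dim_le _ _ _ 2 n%:R 1) => // [|k]; first lra.
pose q := free_count (k * n).
pose cell (w : {ffun 'I_q -> bool}) : set 'rV[R]_n :=
  [set y | exists2 nu : nat -> bool, forall r : 'I_q, nu r = w r & cantor_point nu y].
exists #|{ffun 'I_q -> bool}|; split.
  apply: (@covered_by_cells _ _ _ _ _ cell) => [y [nu y_nu]|w y y'].
    by exists [ffun r : 'I_q => nu r], nu => // r; rewrite ffunE.
  move=> [nu nu_w y_nu] [mu mu_w y'_mu].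
  have eq_k (i : 'I_n) : cantor_trunc nu i k = cantor_trunc mu i k.
    apply: cantor_trunc_agree => r rq.
    by rewrite (nu_w (Ordinal rq)) (mu_w (Ordinal rq)).
  apply: eucl_norm_le_coord => [|i]; first by rewrite invr_ge0 exprn_ge0.
  have X0 : 0 < 2 ^+ k :> R by exact: exprn_gt0.
  rewrite -(ler_pM2l X0) mulfV ?gt_eqF//.
  rewrite -[X in X * _](gtr0_norm X0) -normrM !mxE.
  by have := y_nu i k; have := y'_mu i k; rewrite eq_k ler_norml; lra.
rewrite card_ffun card_bool card_ord mul1r natrX -!powR_mulrn ?powR_ge0//.
rewrite -powRrM mulrC ler_powR//; first lra.
by have /andP[] := free_count_level k.
Qed.

(* If A met every cell below the given prefix, a cover of A by balls of radius
   2^-k would have at least about 2^(k s) members: a ball meets few level-k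
   cells, so these are determined by the ball and their corners modulo 8. *)
Lemma cantor_set_avoid (A : set 'rV[R]_n) nu q :
  (upper_minkowski_dim A < s%:E)%E ->
  exists nu' q', [/\ (q < q')%N, agree q nu nu' &
    forall mu y, agree q' nu' mu -> cantor_point mu y -> ~ A y].
Proof.
move=> /upper_minkowski_dim_lt[s' [d0 [s's d0_gt0 A_cov]]].
apply: contrapT => all_meet.
have meet nu' q' : (q < q')%N -> agree q nu nu' ->
    exists mu y, [/\ agree q' nu' mu, cantor_point mu y & A y].
  move=> qq' eq_nu; apply: contrapT => none; apply: all_meet; exists nu', q'.
  by split=> // mu y eq_mu y_mu Ay; apply: none; exists mu, y.
(* The first summand brings [2 ^- k] below [d0]. The second makes [k (s - s')] exceed the sum of [q]
   prefix bits, [3 n] bits of residues modulo 8, and 1 for the rounding in [free_count]. *)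
pose k := (Num.truncn (d0^-1) + Num.truncn ((q + 3 * n + 1)%:R / (s - s'))).+1.
have k_d0 : (2 ^+ k)^-1 < d0.
  rewrite invf_plt ?posrE ?exprn_gt0//.
  have /lt_le_trans := truncnS_gt (d0^-1); apply.
  rewrite -natrX ler_nat; apply: leq_trans (ltnW (ltn_expl k _)) => //.
  by rewrite /k ltnS leq_addr.
have k_s : (q + 3 * n + 1)%:R < k%:R * (s - s').
  rewrite -ltr_pdivrMr ?subr_gt0//.
  apply: (lt_le_trans (truncnS_gt _)).
  by rewrite ler_nat /k ltnS leq_addl.
clearbody k.
have X0 : 0 < 2 ^+ k :> R by exact: exprn_gt0.
have [|K [ctr A_ctr] K_lt] := A_cov ((2 ^+ k)^-1).
  by rewrite k_d0 invr_gt0 X0.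
pose c := free_count (k * n).
pose W : finType := {ffun 'I_(c - q) -> bool}.
pose word (w : W) r := if (r < q)%N then nu r
  else if insub (r - q)%N is Some i then w i else false.
have word_agree w : agree q nu (word w) by move=> r rq; rewrite /word rq.
have wordP (w : W) : exists bmy : 'I_K * (nat -> bool) * 'rV[R]_n,
    [/\ agree c (word w) bmy.1.2, cantor_point bmy.1.2 bmy.2
      & eucl_ball (ctr bmy.1.1) ((2 ^+ k)^-1) bmy.2].
  (* The maximum covers the case [c <= q], since the new prefix must be strictly longer than [q]. *)
  have [|mu [y [eq_mu y_mu Ay]]] := meet _ (maxn q.+1 c) _ (word_agree w).
    by rewrite leq_max ltnSn.
  have [b _ yb] := A_ctr _ Ay; exists (b, mu, y); split=> //= r rc.
  by apply: eq_mu; rewrite leq_max rc orbT.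
have [f fP] := choice wordP.
pose code w : 'I_K * {ffun 'I_n -> 'I_8} := ((f w).1.1,
  [ffun i : 'I_n => inord (cantor_trunc (f w).1.2 i k %% 8)]).
have code_inj : injective code.
  move=> w w' [eq_b eq_mod].
  have [eq_w pt_w ball_w] := fP w; have [eq_w' pt_w' ball_w'] := fP w'.
  have trunc_eq (i : 'I_n) :
      cantor_trunc (f w).1.2 i k = cantor_trunc (f w').1.2 i k.
    have /ffunP/(_ i) := eq_mod; rewrite !ffunE => /(congr1 val)/=.
    rewrite !inordK ?ltn_mod// => eq8.
    have near_ctr v : eucl_ball (ctr (f w).1.1) ((2 ^+ k)^-1) v ->
        `|2 ^+ k * (v 0 i) - 2 ^+ k * (ctr (f w).1.1 0 i)| <= 1.
      move=> vb; rewrite -mulrBr normrM (gtr0_norm X0) mulrC -ler_pdivlMr//.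
      rewrite mul1r; apply: le_trans vb.
      by have := coord_le_eucl_norm (v - ctr (f w).1.1) i; rewrite !mxE.
    rewrite -eq_b in ball_w'.
    have := near_ctr _ ball_w; have := near_ctr _ ball_w'.
    have := pt_w i k; have := pt_w' i k.
    move: eq8; set z := cantor_trunc _ _ _; set z' := cantor_trunc _ _ _.
    move=> eq8; rewrite !ler_norml => w1 w2 w3 w4.
    have h1 : (z <= z' + 3)%N by rewrite -(ler_nat R) natrD; lra.
    have h2 : (z' <= z + 3)%N by rewrite -(ler_nat R) natrD; lra.
    exact: eq_mod8_close.
  have mu_eq := cantor_trunc_inj _ _ _ trunc_eq.
  apply/ffunP => r; have rc : (q + r < c)%N by have := ltn_ord r; lia.
  have : word w (q + r)%N = word w' (q + r)%N.
    by rewrite eq_w// eq_w'// mu_eq.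
  by rewrite /word ltnNge leq_addr/= addKn valK.
have := leq_card _ code_inj.
rewrite card_prod !card_ffun card_bool !card_ord => card_le.
(* Injectivity gives [2 ^ (c - q) <= K * 8 ^ n], and [K] is below [2 ^ (k s')]; yet [c > k s - 1],
   against the choice of [k]. *)
have : (2 : R) `^ (c - q)%:R < 2 `^ (k%:R * s' + (3 * n)%:R).
  rewrite powR_mulrn// powRD ?pnatr_eq0 ?implybT// powR_mulrn// exprM.
  apply: (@le_lt_trans _ _ (K%:R * (8 ^ n)%:R)).
    by rewrite -natrX -natrM ler_nat.
  rewrite natrX (_ : 2 ^+ 3 = 8) ?ltr_pM2r ?exprn_gt0//; last by rewrite -natrX.
  move: K_lt; rewrite -powR_invn// -powRrM mulrNN; exact.
rewrite ltNge => /negP; apply; apply: ler_powR; first lra.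
have /andP[_] := free_count_level k; rewrite -/c => c_s.
have c_q : (c <= (c - q) + q)%N by lia.
move: c_q; rewrite -(ler_nat R) natrD => c_q.
rewrite -natr1 in c_s; rewrite !natrD in k_s; rewrite mulrBr in k_s.
by lra.
Qed.

(* Baire category: nested cells avoid the members of a countable cover. *)
Lemma packing_dim_cantor_ge (B : set 'rV[R]_n) :
  cantor_set `<=` B -> (s%:E <= packing_dim B)%E.
Proof.
move=> CB; apply: le_ereal_inf_tmp => _ [A_ [_ BA ->]].
rewrite leNgt; apply/negP => sup_lt.
have A_lt i : (upper_minkowski_dim (A_ i) < s%:E)%E.
  by apply: le_lt_trans sup_lt; apply: ereal_sup_ubound; exists i.
have step (x : nat * (nat -> bool) * nat) : exists x' : (nat -> bool) * nat,
    [/\ (x.2 < x'.2)%N, agree x.2 x.1.2 x'.1 &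
      forall mu y, agree x'.2 x'.1 mu -> cantor_point mu y -> ~ A_ x.1.1 y].
  have [nu' [q' H]] := cantor_set_avoid (A_ x.1.1) x.1.2 x.2 (A_lt _).
  by exists (nu', q').
have [f fP] := choice step.
pose st := fix st i := if i is i.+1 then f (i, (st i).1, (st i).2)
  else (fun=> false, 0%N).
have st_lt i : ((st i).2 < (st i.+1).2)%N.
  by have [] := fP (i, (st i).1, (st i).2).
have st_agree i : agree (st i).2 (st i).1 (st i.+1).1.
  by have [] := fP (i, (st i).1, (st i).2).
have st_avoid i mu y : agree (st i.+1).2 (st i.+1).1 mu -> cantor_point mu y ->
    ~ A_ i y.
  by have [_ _] := fP (i, (st i).1, (st i).2); apply.
have st_ge i : (i <= (st i).2)%N.
  by elim: i => // i IH; apply: leq_ltn_trans IH _.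
have st_agree_add i j : agree (st i).2 (st i).1 (st (i + j)%N).1.
  elim: j => [|j IH] r ri; first by rewrite addn0.
  rewrite IH// addnS st_agree//; apply: leq_trans ri _.
  elim: (j) => [|j' IHj]; rewrite ?addn0// addnS (leq_trans IHj)//.
  exact/ltnW/st_lt.
(* Diagonal limit: by stage [r.+1] at least [r.+1] bits are settled, so bit [r] is final. *)
pose nu r := (st r.+1).1 r.
have nu_agree i : agree (st i).2 (st i).1 nu.
  move=> r ri; rewrite /nu; case: (leqP i r.+1) => [/subnKC <-|/ltnW/subnKC ir].
    exact: st_agree_add.
  by rewrite -[in LHS]ir; apply/esym/st_agree_add/st_ge.
have [y y_nu] := cantor_point_exists nu.
have [i _ Aiy] : (\bigcup_i A_ i) y by apply: BA; apply: CB; exists nu.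
exact: st_avoid (nu_agree i.+1) y_nu Aiy.
Qed.

End Cantor.

(** * Linear forms and the faces of the polytope *)

Section Dot.
Context {R : realType} {n : nat}.
Implicit Types (a x y : 'rV[R]_n).

Lemma dotDr a x y : dot a (x + y) = dot a x + dot a y.
Proof.
by rewrite /dot -big_split; apply: eq_bigr => i _; rewrite mxE mulrDr.
Qed.

Lemma dotZr (c : R) a x : dot a (c *: x) = c * dot a x.
Proof.
by rewrite /dot mulr_sumr; apply: eq_bigr => i _; rewrite mxE mulrCA.
Qed.

Lemma dotZl (c : R) a x : dot (c *: a) x = c * dot a x.
Proof.
by rewrite /dot mulr_sumr; apply: eq_bigr => i _; rewrite mxE mulrA.
Qed.

Lemma dot_gt0 a : a != 0 -> 0 < dot a a.
Proof.
move=> /rV0Pn[i ai]; rewrite /dot (bigD1 i)//= ltr_pwDl//.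
  by rewrite -expr2 exprn_even_gt0.
by apply: sumr_ge0 => j _; rewrite -expr2 sqr_ge0.
Qed.

Lemma dot_continuous a : continuous (dot a : 'rV[R]_n -> R).
Proof.
apply: continuous_big => [|i _ x]; first exact: add_continuous.
by apply: cvgMl_tmp; [exact: nbhs_filter|exact: coord_continuous].
Qed.

End Dot.

Section Polytope.
Context {R : realType} {n m : nat}.
Variables (a : 'I_m -> 'rV[R]_n) (b : 'I_m -> R).
Let K := \bigcap_(i in [set: 'I_m]) halfspace (a i) (b i).

(** A small positive multiple of [a i] still lies in [K], and [dot (a i)] is positive there. *)
Lemma interior_halfspace_gt0 i : a i != 0 -> interior K 0 -> 0 < b i.
Proof.
move=> ai0 K0.
have cont : (fun c : R => c *: a i) @ (0 : R) --> (0 : 'rV[R]_n).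
  by rewrite -[X in _ --> X](scale0r (a i)); exact: scalel_continuous.
have /nbhs_ballP[d /= d0 dK] : \forall c \near (0 : R), K (c *: a i).
  exact: cont.
have := dK (d / 2); rewrite /ball/= sub0r normrN gtr0_norm ?divr_gt0//.
move=> /(_ _ i I) /=; rewrite ltr_pdivrMr// ltr_pMr// ltr1n => /(_ isT).
rewrite /halfspace/= dotZr; apply: lt_le_trans.
by rewrite mulr_gt0 ?divr_gt0 ?dot_gt0.
Qed.

(** Since [K] is closed, [p] satisfies all the inequalities; if these finitely many were all strict,
    continuity would make [p] interior. *)
Lemma boundary_face p : boundary K p -> exists i, dot (a i) p = b i.
Proof.
move=> [Kp not_int].
have Kcl : closed K.
  apply: closed_bigI => i _.
  apply: (@preimage_closed _ _ (dot (a i)) [set x | x <= b i]).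
    by move=> x _; exact: dot_continuous.
  exact: closed_le.
have {}Kp : K p by rewrite (closure_id K).1.
apply: contrapT => no_face; apply: not_int.
have strict i : dot (a i) p < b i.
  rewrite lt_neqAle; apply/andP; split; last exact: Kp.
  by apply/eqP => ap; apply: no_face; exists i.
suff : \forall x \near p, forall i, dot (a i) x <= b i.
  by apply: filterS => x xK i _; exact: xK.
apply: (@filter_forall _ _ (fun i x => dot (a i) x <= b i) (nbhs p)) => i.
have : \forall t \near dot (a i) p, t <= b i.
  by apply: filterS (lt_nbhsl (strict i)) => t /ltW.
exact: dot_continuous.
Qed.

End Polytope.

(** * Union of the strips and the Cantor set *)

Theorem mainTheorem18 (R : realType) (n m : nat) (n_gt0 : (0 < n)%N)
    (K P : set 'rV[R]_n)
    (K_polytope : convex_polytope_with_faces m K)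
    (K_interior : interior K 0)
    (P_def : P = boundary K)
    (eps : R) (eps_gt0 : 0 < eps) (eps_le : eps <= 1 / m%:R) :
  exists B : set 'rV[R]_n,
    (forall x : 'rV[R]_n, exists r : R,
        0 < r /\ homothetic_copy P x r `<=` B) /\
    packing_dim B = (n%:R - 1 / m%:R + eps)%:E.
Proof.
destruct n as [|n]; first by [].
(* For [m = 0] the convention [1 / 0 = 0] makes [eps_le] contradict [eps_gt0]. From here on the
   number of faces is [m.+1]. *)
destruct m as [|m]; first by move: eps_le; rewrite invr0 mulr0 leNgt eps_gt0.
have [_ [a [b [a_neq0 K_eq _]]]] := K_polytope.
set s := n.+1%:R - 1 / m.+1%:R + eps.
(* [sigma] is the share of [s] across a hyperplane; the [n] directions along it contribute 1
   each. *)
pose sigma := 1 - 1 / m.+1%:R + eps.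
have s_sigma : s = n%:R + sigma by rewrite /s /sigma -natr1; ring.
have m1 : 1 / m.+1%:R <= 1 :> R by rewrite ler_pdivrMr ?mul1r ?ler1n ?ltr0n.
have sigma_ge0 : 0 <= sigma by rewrite addr_ge0 ?subr_ge0// ltW.
have s_ge0 : 0 <= s by rewrite s_sigma addr_ge0.
(* The upper bound on [eps] keeps [s] within the dimension of the space, as the Cantor set
   requires. *)
have s_le : s <= n.+1%:R by rewrite /s -addrA gerDl addrC subr_le0.
have meps : 0 < m.+1%:R * eps by rewrite mulr_gt0// ltr0n.
(* This size makes [N ^ (m.+1 * eps)] at least 3, so that [eps] absorbs the factor 3 of the cell
   count; the added 3 gives [2 < N]. *)
pose N := ((Num.truncn (3 `^ (m.+1%:R * eps)^-1 : R)).+1 + 3)%N.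
have N_gt2 : (2 < N)%N by rewrite /N; lia.
have N0 : 0 < N%:R :> R by rewrite ltr0n; lia.
have N3 : 3 <= N%:R `^ (m.+1%:R * eps).
  have -> : 3 = (3 `^ (m.+1%:R * eps)^-1) `^ (m.+1%:R * eps) :> R.
    by rewrite -powRrM mulVf ?gt_eqF// powRr1.
  apply: ge0_ler_powR; rewrite ?nnegrE ?powR_ge0// ?(ltW meps)//.
  by apply: (le_trans (ltW (truncnS_gt _))); rewrite ler_nat /N leq_addr.
have N_sigma : (3 * N ^ m)%:R <= (N ^ m.+1)%:R `^ sigma.
  rewrite natrX -powR_mulrn ?(ltW N0)// -powRrM.
  have -> : m.+1%:R * sigma = m%:R + m.+1%:R * eps.
    by rewrite /sigma -natr1; field; rewrite natr1 pnatr_eq0.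
  rewrite powRD ?(gt_eqF N0) ?implybT// powR_mulrn ?(ltW N0)//.
  by rewrite natrM natrX mulrC ler_pM2l ?exprn_gt0.
have b_gt0 i : 0 < b i.
  by apply: (@interior_halfspace_gt0 _ _ _ a b); rewrite -?K_eq.
(* The factor [N ^ i] moves the controlled digits of face [i] to the positions congruent to [i]
   modulo [m.+1]. *)
pose e (i : 'I_m.+1) : 'rV[R]_n.+1 := (N%:R ^+ i / b i) *: a i.
have e_neq0 i : e i != 0.
  by rewrite scaler_eq0 negb_or a_neq0 andbT gt_eqF// divr_gt0// exprn_gt0.
pose piece (x : option ('I_m.+1 * nat)) : set 'rV[R]_n.+1 :=
  if x is Some (i, L) then strips (e i) N m L else @cantor_set R n.+1 s.
pose B := \bigcup_(x in [set: option ('I_m.+1 * nat)]) piece x.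
exists B; split.
  move=> x.
  have N_gt1 : (1 < N)%N by lia.
  (* One sequence serves all faces: position [k] is devoted to face [k %% m.+1]. *)
  have [r [r_gt0 r_shift]] := @simultaneous_shift R N
    (fun k => dot (a (inord (k %% m.+1))) x / b (inord (k %% m.+1))) N_gt1.
  exists r; split=> // _ [p Pp <-].
  have [i p_face] : exists i, dot (a i) p = b i.
    by apply: boundary_face; rewrite -K_eq -P_def.
  pose y := x + r *: p.
  exists (Some (i, (Num.truncn `|y|).+1)) => //; split.
    move=> q; apply: (@le_trans _ _ `|y|); last exact/ltW/truncnS_gt.
    rewrite /Num.norm/= mx_normrE.
    exact: (le_bigmax _ (fun ij : 'I_1 * 'I_n.+1 => `|y ij.1 ij.2|) (0, q)).
  move=> j; have [z z_shift] := r_shift (j * m.+1 + i)%N; exists z.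
  have im : ((j * m.+1 + i) %% m.+1)%N = i by rewrite modnMDl modn_small.
  rewrite im inord_val in z_shift.
  (* As [dot (a i) p = b i], the term [r *: p] contributes the same shift [r] for every point of the
     face. *)
  rewrite (_ : _ * _ = N%:R ^+ (j * m.+1 + i) * (dot (a i) x / b i + r))//.
  rewrite dotZl dotDr dotZr p_face exprD natrX -exprM [(m.+1 * j)%N]mulnC.
  by field; rewrite gt_eqF.
apply/eqP; rewrite eq_le; apply/andP; split; last first.
  apply: packing_dim_cantor_ge => // y Cy; by exists None.
(* Numbers that code no index repeat the Cantor set. *)
pose A_ k := if unpickle k is Some x then piece x else piece None.
apply: (@packing_dim_le _ _ _ A_).
- have piece_bnd x : bounded_set (piece x).
    case: x => [[i L]|]; last exact: cantor_set_bounded.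
    by apply: (@bounded_set_coord _ _ _ L%:R) => y [].
  by move=> k; rewrite /A_; case: unpickle => *; exact: piece_bnd.
- by move=> y [x _ xy]; exists (pickle x) => //; rewrite /A_ pickleK.
have piece_dim x : (upper_minkowski_dim (piece x) <= s%:E)%E.
  case: x => [[i L]|]; last exact: cantor_set_dim.
  by rewrite s_sigma; exact: strips_dim.
by move=> k; rewrite /A_; case: unpickle => *; exact: piece_dim.
Qed.
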